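(* Let $G$ be a finite nilpotent group and let $k\geqslant 1$. Then for every connected component $C$ of the Andrews--Curtis graph $\Delta_k(G/[G,G],G/[G,G])$, the preimage of $C$ in $\Delta_k(G,G)$ (under the map induced by the canonical epimorphism $G\to G/[G,G]$) is connected.
   Context: For a group $G$ and an integer $k\geqslant 1$, the Andrews--Curtis graph $\Delta_k(G,G)$ is the undirected graph whose vertices are the $k$-tuples $(h_1,\ldots,h_k)\in G^k$ that generate $G$ as a normal subgroup, i.e. the normal closure $\langle h_1^G,\ldots,h_k^G\rangle$ of $\{h_1,\ldots,h_k\}$ equals $G$. Two vertices are joined by an edge if one is obtained from the other by one of the following moves, each changing only the $i$-th component: $x_i\mapsto x_ix_j^{\pm1}$ ($i\ne j$); $x_i\mapsto x_j^{\pm1}x_i$ ($i\neq j$); $x_i\mapsto x_i^{-1}$; $x_i\mapsto x_i^w=w^{-1}x_iw$ for an arbitrary $w\in G$. An epimorphism $G\to H$ of groups, applied componentwise, induces an adjacency-preserving map of graphs $\Delta_k(G,G)\to\Delta_k(H,H)$; the preimage of a connected component is the subgraph of $\Delta_k(G,G)$ induced on the set of vertices mapped into that component. A graph is connected if any two of its vertices are joined by a path. *)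

(* Defs.v *)
From mathcomp Require Import all_boot all_fingroup all_solvable.

Set Implicit Arguments.
Unset Strict Implicit.
Unset Printing Implicit Defensive.

Import GroupScope.

Section Graphs.

Variable T : finType.
Implicit Types (V C : {set T}) (e : rel T).

Definition induced V e : rel T := [rel x y | [&& x \in V, y \in V & e x y]].

Definition graph_connected V e : Prop :=
  {in V &, forall x y, connect (induced V e) x y}.

(* Meant for symmetric [e]. *)
Definition graph_component V e C : Prop :=
  exists2 x, x \in V & C = [set y in V | connect (induced V e) x y].

End Graphs.

Section AndrewsCurtis.

Variables (gT : finGroupType) (k : nat).
Implicit Types (G : {set gT}) (h : {ffun 'I_k -> gT}).

Definition ac_vertices G : {set {ffun 'I_k -> gT}} :=
  [set h : {ffun 'I_k -> gT} |
    [forall i, h i \in G] && (<<\bigcup_i (h i ^: G)>> == G)].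

Definition ac_move G : rel {ffun 'I_k -> gT} := fun h h' =>
  [exists i, [forall j, (j != i) ==> (h' j == h j)] &&
    [|| [exists j, (j != i) &&
          [|| h' i == h i * h j, h' i == h i * (h j)^-1,
              h' i == h j * h i | h' i == (h j)^-1 * h i]],
        h' i == (h i)^-1
      | [exists w in G, h' i == h i ^ w]]].

(* The Andrews-Curtis graph of [G] is the pair [ac_vertices G], [ac_edge G]. *)
Definition ac_edge G : rel {ffun 'I_k -> gT} := fun h h' =>
  ac_move G h h' || ac_move G h' h.

Definition ac_quotient (N : {set gT}) h : {ffun 'I_k -> coset_of N} :=
  [ffun i => coset N (h i)].

Definition ac_preimage G (N : {set gT}) (C : {set {ffun 'I_k -> coset_of N}}) :
    {set {ffun 'I_k -> gT}} :=
  [set h in ac_vertices G | ac_quotient N h \in C].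

End AndrewsCurtis.

Arguments ac_vertices {gT} k G.
Arguments ac_edge {gT} k G.

(* Main.v *)
Require Import Defs.
From mathcomp Require Import all_boot all_fingroup all_solvable.
Import GroupScope.

(** Call a normal subgroup [L] absorbable if every coordinate of every vertex
    can be multiplied by any element of [L] along a path.  The moves
    [x_i -> x_i x_j^-1], [x_j -> x_j^w], [x_i -> x_i x_j], [x_j -> x_j^(w^-1)]
    multiply [x_i] by [[x_j, w]].  If ['L_(n + 2)(G)] is absorbable then, modulo it,
    the commutators [[g, w]] with [w] in ['L_n(G)] are central and
    multiplicative in [g]; as the [x_j] normally generate [G], this makes
    ['L_(n + 1)(G)] absorbable.  Nilpotency starts this descending induction, which
    ends with [[G, G]] absorbable.  A path in the graph of [G / [G, G]] lifts to
    a path in the graph of [G] ending at a vertex congruent modulo [[G, G]] to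
    the target, and absorption corrects the endpoint. *)

(** * Paths in induced subgraphs *)

Lemma closed_connect_induced (T : finType) (e : rel T) (V : {set T}) :
    (forall x y, x \in V -> e x y -> y \in V) ->
  forall x y, x \in V -> connect e x y -> connect (induced V e) x y.
Proof.
move=> clV x y Vx /connectP[p + ->] {y}.
elim: p x Vx => [|z p IHp] x Vx /=; first by rewrite connect0.
case/andP=> exz /IHp IH; have Vz := clV _ _ Vx exz.
by apply: connect_trans (IH Vz); apply: connect1; rewrite /induced /= Vx Vz.
Qed.

Lemma connect_induced (T : finType) (e : rel T) (V : {set T}) x y :
  connect (induced V e) x y -> connect e x y.
Proof.
by apply: connect_sub => u v /= /and3P[_ _ /connect1].
Qed.

(** * Moves as updates of one coordinate, and the vertex set *)

Section Moves.

Context {gT : finGroupType} {k : nat}.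
Implicit Types (G L M N : {group gT}) (h : {ffun 'I_k -> gT}) (i j : 'I_k).

Definition upd h i x : {ffun 'I_k -> gT} :=
  [ffun j => if j == i then x else h j].

Lemma updE h i x j : upd h i x j = if j == i then x else h j.
Proof. exact: ffunE. Qed.

Lemma upd_same h i x : upd h i x i = x.
Proof. by rewrite updE eqxx. Qed.

Lemma upd_neq h i x j : j != i -> upd h i x j = h j.
Proof. by rewrite updE => /negPf->. Qed.

Lemma upd_id h i : upd h i (h i) = h.
Proof. by apply/ffunP=> j; rewrite updE; case: eqP => [->|]. Qed.

Lemma upd_upd h i x y : upd (upd h i x) i y = upd h i y.
Proof. by apply/ffunP=> j; rewrite !updE; case: eqP. Qed.

Lemma updC h i j x y :
  j != i -> upd (upd h i x) j y = upd (upd h j y) i x.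
Proof.
move=> ji; apply/ffunP=> l; rewrite !updE.
by case: (eqVneq l j) => // ->; rewrite (negPf ji).
Qed.

(** Only the new value of the moved coordinate is recorded, so that a move becomes an [upd] and a
    case analysis yields the six kinds of move. *)
Variant ac_step (G : {set gT}) h i : gT -> Prop :=
  | StepMulR j of j != i : ac_step G h i (h i * h j)
  | StepMulVR j of j != i : ac_step G h i (h i * (h j)^-1)
  | StepMulL j of j != i : ac_step G h i (h j * h i)
  | StepMulVL j of j != i : ac_step G h i ((h j)^-1 * h i)
  | StepInv : ac_step G h i (h i)^-1
  | StepConj w of w \in G : ac_step G h i (h i ^ w).

Lemma ac_moveP (G : {set gT}) h h' :
  reflect (exists i x, h' = upd h i x /\ ac_step G h i x) (ac_move G h h').
Proof.
apply: (iffP existsP) => [[i /andP[/forallP eqh' st]]|[i [x [-> st]]]].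
  exists i, (h' i); split.
    apply/ffunP=> j; rewrite updE; case: eqVneq => [->//|ji].
    by move/implyP: (eqh' j) => /(_ ji)/eqP.
  case/or3P: st => [/existsP[j /andP[ji]]|/eqP->|/exists_inP[w Gw /eqP->]].
  - by case/or4P=> /eqP->; constructor.
  - by constructor.
  - by constructor.
exists i; apply/andP; split.
  by apply/forallP=> j; apply/implyP=> ji; rewrite upd_neq.
rewrite upd_same; case: st => [j ji|j ji|j ji|j ji||w Gw].
- by apply/or3P/Or31/existsP; exists j; rewrite ji eqxx.
- by apply/or3P/Or31/existsP; exists j; rewrite ji eqxx !orbT.
- by apply/or3P/Or31/existsP; exists j; rewrite ji eqxx !orbT.
- by apply/or3P/Or31/existsP; exists j; rewrite ji eqxx !orbT.
- by rewrite eqxx orbT.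
- by apply/or3P/Or33/exists_inP; exists w.
Qed.

Lemma ac_move_sym G : symmetric (@ac_move gT k G).
Proof.
suff imp h h' : ac_move G h h' -> ac_move G h' h.
  by move=> h h'; apply/idP/idP; apply: imp.
case/ac_moveP=> i [x [-> st]]; apply/ac_moveP; exists i, (h i).
split; first by rewrite upd_upd upd_id.
case: st => [j ji|j ji|j ji|j ji||w Gw]; set g := upd _ _ _.
- have ->: h i = g i * (g j)^-1 by rewrite upd_same upd_neq // mulgK.
  by constructor.
- have ->: h i = g i * g j by rewrite upd_same upd_neq // mulgKV.
  by constructor.
- have ->: h i = (g j)^-1 * g i by rewrite upd_same upd_neq // mulKg.
  by constructor.
- have ->: h i = g j * g i by rewrite upd_same upd_neq // mulKVg.
  by constructor.
- have ->: h i = (g i)^-1 by rewrite upd_same invgK.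
  by constructor.
- have ->: h i = g i ^ w^-1 by rewrite upd_same conjgK.
  by constructor; rewrite groupV.
Qed.

Lemma ac_edgeE G h h' : ac_edge k G h h' = ac_move G h h'.
Proof. by rewrite /ac_edge [ac_move G h' h]ac_move_sym orbb. Qed.

Lemma ac_edge_connect_sym G : connect_sym (ac_edge k G).
Proof. by apply: sym_connect_sym => h h'; rewrite !ac_edgeE ac_move_sym. Qed.

Lemma step_connect G h i x :
  ac_step G h i x -> connect (ac_edge k G) h (upd h i x).
Proof.
by move=> st; apply: connect1; rewrite ac_edgeE; apply/ac_moveP; exists i, x.
Qed.

Lemma ac_move_mem G N h h' :
  G \subset 'N(N) -> ac_move G h h' -> (forall i, h i \in N) ->
  forall i, h' i \in N.
Proof.
move=> nNG /ac_moveP[i [x [-> st]]] Nh j; rewrite updE; case: eqP => // _.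
by case: st => [l _|l _|l _|l _||w /(subsetP nNG)/memJ_norm->];
   rewrite ?groupM ?groupV.
Qed.

(** The normal closure is replaced by its universal property. In this form, showing that a property
    holds on all of [G] amounts to showing that it cuts out a normalised subgroup containing the
    entries of [h]. *)
Lemma ac_verticesP G h :
  reflect ((forall i, h i \in G) /\
           (forall N, G \subset 'N(N) -> (forall i, h i \in N) -> G \subset N))
          (h \in ac_vertices k G).
Proof.
rewrite inE; apply: (iffP andP) => [[/forallP Gh /eqP defG]|[Gh genG]].
  split=> // N nNG Nh; rewrite -{1}defG gen_subG; apply/bigcupsP=> i _.
  by rewrite class_sub_norm.
split; first exact/forallP.
rewrite eqEsubset gen_subG; apply/andP; split.
  by apply/bigcupsP=> i _; apply: class_subG.
apply: genG => [|i].
  apply/norms_gen/norms_bigcup/bigcapsP=> i _; exact: class_norm.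
by apply/mem_gen/bigcupP; exists i => //; apply: class_refl.
Qed.

(** Moves are reversible, so a normalised subgroup containing the entries of [h'] also contains
    those of [h]. *)
Lemma ac_vertices_edge G h h' :
  h \in ac_vertices k G -> ac_edge k G h h' -> h' \in ac_vertices k G.
Proof.
rewrite ac_edgeE => /ac_verticesP[Gh genG] mv; apply/ac_verticesP; split.
  exact: ac_move_mem (normG G) mv Gh.
move=> N nNG Nh'; apply: (genG) => //; apply: ac_move_mem nNG _ Nh'.
by rewrite ac_move_sym.
Qed.

Lemma ac_vertices_connect G h h' :
  h \in ac_vertices k G -> connect (ac_edge k G) h h' -> h' \in ac_vertices k G.
Proof.
move=> Vh /connectP[p + ->]; elim: p h Vh => //= h1 p IHp h Vh /andP[e1].
by move=> pth; apply: IHp pth; apply: ac_vertices_edge Vh e1.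
Qed.

Lemma connect_mul_commg G h i j w :
  w \in G -> connect (ac_edge k G) h (upd h i (h i * [~ h j, w])).
Proof.
move=> Gw; case: (eqVneq j i) => [->|ji].
  (* Here [h i * [~ h i, w] = h i ^ w], a single conjugation. *)
  by rewrite -conjg_mulR; apply/step_connect/StepConj.
have ij : i != j by rewrite eq_sym.
apply: connect_trans (step_connect _ _ _ _ (StepMulVR G h i j ji)) _.
set h1 := upd h i _.
apply: connect_trans (step_connect _ _ _ _ (StepConj G h1 j w Gw)) _.
set h2 := upd h1 j _.
apply: connect_trans (step_connect _ _ _ _ (StepMulR G h2 i j ji)) _.
set h3 := upd h2 i _.
have Gw' : w^-1 \in G by rewrite groupV.
apply: connect_trans (step_connect _ _ _ _ (StepConj G h3 j _ Gw')) _.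
suff ->: upd h3 j (h3 j ^ w^-1) = upd h i (h i * [~ h j, w]) by [].
have h1i : h1 i = h i * (h j)^-1 by rewrite upd_same.
have h1j : h1 j = h j by rewrite upd_neq.
have h2i : h2 i = h i * (h j)^-1 by rewrite upd_neq.
have h2j : h2 j = h j ^ w by rewrite upd_same h1j.
have h3j : h3 j = h j ^ w by rewrite upd_neq.
rewrite h3j conjgK /h3 h2i h2j updC // /h2 upd_upd -h1j upd_id upd_upd.
by rewrite commgEl -mulgA.
Qed.

(** * Absorption along the lower central series *)

Definition absorbs G (L : {set gT}) :=
  forall h i z, h \in ac_vertices k G -> z \in L ->
    connect (ac_edge k G) h (upd h i (h i * z)).

Lemma absorbs1 G : absorbs G 1.
Proof. by move=> h i z _ /set1P->; rewrite mulg1 upd_id. Qed.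

Lemma absorbs_commg G (K L : {group gT}) :
    K <| G -> L = [~: K, G] :> {set gT} ->
  absorbs G [~: L, G] -> absorbs G L.
Proof.
move=> nsKG defL absM h i z Vh.
have [sKG nKG] := andP nsKG.
have nsLG : L <| G.
  by rewrite /normal defL commGC commg_subl normsR ?(subset_trans sKG) ?normG.
have [sLG nLG] := andP nsLG.
set M := [~: L, G] in absM.
have sML : M \subset L by rewrite commg_subl.
have [Gh genG] := ac_verticesP _ _ Vh.
(* Absorbing one factor leads to another vertex, congruent to [h] modulo [L]. Hence [S] asks for
   absorption at all such vertices, and a product can be absorbed factor by factor. *)
pose near h' := (h' \in ac_vertices k G) && [forall j, (h j)^-1 * h' j \in L].
pose S := [set z in L | [forall h' : {ffun 'I_k -> gT}, near h' ==>
  [forall j, connect (ac_edge k G) h' (upd h' j (h' j * z))]]].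
have SP y : reflect (y \in L /\ (forall h' j, near h' ->
      connect (ac_edge k G) h' (upd h' j (h' j * y)))) (y \in S).
  rewrite inE; apply: (iffP andP) => [[Ly /forallP H]|[Ly H]]; split=> //.
    by move=> h' j nh'; move/implyP: (H h') => /(_ nh')/forallP.
  by apply/forallP=> h'; apply/implyP=> nh'; apply/forallP=> j; apply: H.
have near_upd h' j y : near h' -> y \in L ->
    connect (ac_edge k G) h' (upd h' j (h' j * y)) ->
    near (upd h' j (h' j * y)).
  case/andP=> Vh' /forallP Lh' Ly conn; apply/andP; split.
    exact: ac_vertices_connect conn.
  apply/forallP=> l; rewrite updE; case: eqP => [->|] //.
  by rewrite mulgA groupM.
have gS : group_set S.
  apply/group_setP; split.
    by apply/SP; split=> // h' j _; rewrite mulg1 upd_id.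
  move=> x y /SP[Lx Cx] /SP[Ly Cy]; apply/SP; split; first exact: groupM.
  move=> h' j nh'; have c1 := Cx h' j nh'; apply: connect_trans c1 _.
  have := Cy _ j (near_upd _ j _ nh' Lx (Cx h' j nh')).
  by rewrite upd_same upd_upd mulgA.
have sMS : M \subset S.
  apply/subsetP=> m Mm; apply/SP; split; first exact: (subsetP sML).
  by move=> h' j /andP[Vh' _]; apply: absM.
(* [x ^ y = x * [~ x, y]], and the commutator lies in [M], hence in [S]. *)
have SJ x y : x \in S -> y \in G -> x ^ y \in group gS.
  move=> Sx Gy; rewrite conjg_mulR groupM //.
  by apply: (subsetP sMS); rewrite mem_commg //; case/SP: Sx.
(* Closure of [T] under products comes from [[~ x * y, w] = [~ x, w] ^ y * [~ y, w]]. Once [T] is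
   all of [G], the set [S] contains the generators of [L = [~: K, G]]. *)
pose T := [set g in G | [forall w in K, [~ g, w] \in S]].
have TP g :
    reflect (g \in G /\ {in K, forall w, [~ g, w] \in group gS}) (g \in T).
  rewrite inE; apply: (iffP andP) => [[Gg /forall_inP H]|[Gg H]]; split=> //.
  by apply/forall_inP.
have gTT : group_set T.
  apply/group_setP; split.
    by apply/TP; split=> // w _; rewrite comm1g group1.
  move=> x y /TP[Gx Tx] /TP[Gy Ty]; apply/TP; split; first exact: groupM.
  by move=> w Kw; rewrite commMgJ groupM ?SJ ?Ty ?Tx.
have nTG : G \subset 'N(group gTT).
  apply/subsetP=> x Gx; rewrite inE; apply/subsetP=> _ /imsetP[g /TP[Gg Tg] ->].
  apply/TP; split; first exact: groupJ.
  move=> w Kw; rewrite -[w](conjgKV x) -conjRg SJ // Tg //.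
  by rewrite memJ_norm // groupV (subsetP nKG).
(* At a near vertex [h'] the available factor is [[~ h' j, w]], not [c = [~ h j, w]]. With
   [h' j = h j * u] and [u] in [L], the two differ by [m] in [M], and [m^-1] is absorbed by
   hypothesis. *)
have Th j : h j \in group gTT.
  apply/TP; split=> // w Kw; have Gw := subsetP sKG w Kw.
  have Lc g : g \in G -> [~ g, w] \in L.
    by move=> Gg; rewrite defL commGC mem_commg.
  apply/SP; split; first exact: Lc.
  move=> h' l nh'; have [Vh' /forallP/(_ j) Lu] := andP nh'.
  set c := [~ h j, w]; set u := (h j)^-1 * h' j in Lu.
  have Gu : u \in G := subsetP sLG u Lu.
  pose m := [~ c, u] * [~ u, w].
  have Mm : m \in M by rewrite groupM // mem_commg // Lc.
  have cm : [~ h' j, w] = c * m.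
    by rewrite -[h' j](mulKVg (h j)) -/u commMgJ conjg_mulR -mulgA.
  have c1 := connect_mul_commg G h' l j w Gw.
  apply: (connect_trans c1); set h1 := upd h' l _ in c1 *.
  have Mmv : m^-1 \in M by rewrite groupV.
  have := absM h1 l m^-1 (ac_vertices_connect _ _ _ Vh' c1) Mmv.
  by rewrite /h1 upd_same upd_upd cm (mulgA _ c) mulgK.
have sGT := genG _ nTG Th.
have sLS : L \subset group gS.
  rewrite defL commGC gen_subG; apply/subsetP=> _ /imset2P[g w Gg Kw ->].
  by case/TP: (subsetP sGT g Gg) => _; apply.
case/(subsetP sLS)/SP=> _; apply; apply/andP; split=> //.
by apply/forallP=> j; rewrite mulVg group1.
Qed.

Lemma absorbs_der1 G : nilpotent G -> absorbs G [~: G, G].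
Proof.
case/lcnP=> n Ln1.
(* The induction starts one term after the trivial term ['L_n.+1(G)], so that [d = n] lands on
   ['L_2(G) = [~: G, G]] even when [n = 0]. *)
suff abs d : d <= n -> absorbs G 'L_(n - d).+2(G).
  by have := abs n (leqnn n); rewrite subnn.
elim: d => [_|d IHd ltdn].
  by rewrite subn0 lcnSn Ln1 comm1G; apply: absorbs1.
apply: (absorbs_commg G 'L_(n - d.+1).+1(G)); first exact: lcn_normal.
  by rewrite /= lcnSn.
by rewrite /= -lcnSn subnSK //; apply/IHd/ltnW.
Qed.

(** The coordinates are corrected one at a time; [mix n] is the tuple after the first [n]
    corrections. *)
Lemma absorbs_congruent G L h h' :
    absorbs G L -> h \in ac_vertices k G ->
  (forall i, (h i)^-1 * h' i \in L) -> connect (ac_edge k G) h h'.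
Proof.
move=> absL Vh Lhh'.
pose mix n : {ffun 'I_k -> gT} :=
  [ffun i : 'I_k => if i < n then h' i else h i].
suff conn n : n <= k -> connect (ac_edge k G) h (mix n).
  suff ->: h' = mix k by apply: conn.
  by apply/ffunP=> i; rewrite ffunE ltn_ord.
elim: n => [_|n IHn ltnk].
  by suff ->: mix 0 = h by []; apply/ffunP=> i; rewrite ffunE.
have conn := IHn (ltnW ltnk); apply: (connect_trans conn).
pose i := Ordinal ltnk.
have := absL _ i _ (ac_vertices_connect _ _ _ Vh conn) (Lhh' i).
rewrite ffunE ltnn mulKVg; congr (connect _ _ _); apply/ffunP=> j.
rewrite updE !ffunE; case: eqVneq => [->|ji]; first by rewrite leqnn.
by rewrite [j < n.+1]leq_eqVlt eqSS -[n]/(val i) (inj_eq val_inj) (negPf ji).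
Qed.

End Moves.

(** * Projecting and lifting paths along a quotient *)

Section Quotient.

Context {gT : finGroupType} {k : nat}.
Variables G N : {group gT}.
Hypothesis nNG : G \subset 'N(N).
Implicit Types h : {ffun 'I_k -> gT}.

Lemma ac_quotient_upd h i x :
  ac_quotient N (upd h i x) = upd (ac_quotient N h) i (coset N x).
Proof. by apply/ffunP=> j; rewrite !ffunE; case: eqP. Qed.

Lemma ac_step_quotient h i x :
  (forall j, h j \in G) -> ac_step G h i x ->
  ac_step (G / N) (ac_quotient N h) i (coset N x).
Proof.
move=> Gh; have Nh j : h j \in 'N(N) by rewrite (subsetP nNG).
have qE j : coset N (h j) = ac_quotient N h j by rewrite ffunE.
case=> [j ji|j ji|j ji|j ji||w Gw]; last 1 first.
  rewrite morphJ ?(subsetP nNG) //= qE.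
  by constructor; apply: mem_quotient.
all: by rewrite ?morphM ?morphV ?groupV //= ?qE; constructor.
Qed.

(** Only a conjugation involves an element outside the tuple, and its conjugator has a preimage in
    [G]. *)
Lemma ac_step_lift h i y :
  (forall j, h j \in G) -> ac_step (G / N) (ac_quotient N h) i y ->
  exists2 x, ac_step G h i x & y = coset N x.
Proof.
move=> Gh; have Nh j : h j \in 'N(N) by rewrite (subsetP nNG).
have qE j : ac_quotient N h j = coset N (h j) by rewrite ffunE.
case=> [j ji|j ji|j ji|j ji||_ /morphimP[w Nw Gw ->]].
- by exists (h i * h j); [constructor | rewrite !qE morphM].
- by exists (h i * (h j)^-1); [constructor | rewrite !qE morphM ?morphV ?groupV].
- by exists (h j * h i); [constructor | rewrite !qE morphM].
- by exists ((h j)^-1 * h i); [constructor | rewrite !qE morphM ?morphV ?groupV].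
- by exists (h i)^-1; [constructor | rewrite !qE morphV].
- by exists (h i ^ w); [constructor | rewrite !qE morphJ].
Qed.

Lemma ac_edge_quotient h h' :
  (forall j, h j \in G) -> ac_edge k G h h' ->
  ac_edge k (G / N) (ac_quotient N h) (ac_quotient N h').
Proof.
move=> Gh; rewrite !ac_edgeE => /ac_moveP[i [x [-> st]]].
apply/ac_moveP; exists i, (coset N x); split; first exact: ac_quotient_upd.
exact: ac_step_quotient.
Qed.

(** The path is lifted edge by edge from [h]; its endpoint is controlled only modulo [N]. *)
Lemma ac_connect_lift h t :
    (forall j, h j \in G) -> connect (ac_edge k (G / N)) (ac_quotient N h) t ->
  exists2 h', connect (ac_edge k G) h h' & t = ac_quotient N h'.
Proof.
move=> Gh /connectP[p + ->] {t}; elim: p h Gh => [|t p IHp] h Gh /=.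
  by exists h.
case/andP; rewrite ac_edgeE => /ac_moveP[i [y [-> st]]].
have [x stx ->] := ac_step_lift _ _ _ Gh st.
rewrite -[upd _ _ _]ac_quotient_upd => pth.
have mv : ac_move G h (upd h i x) by apply/ac_moveP; exists i, x.
have [h' c' ->] := IHp _ (ac_move_mem _ _ _ _ (normG G) mv Gh) pth.
by exists h' => //; apply: connect_trans (connect1 _) c'; rewrite ac_edgeE.
Qed.

End Quotient.

(** * Connectedness of the preimages *)

Theorem theorem5p14 (gT : finGroupType) (G : {group gT}) (k : nat) :
  nilpotent G -> (1 <= k)%N ->
  forall C : {set {ffun 'I_k -> coset_of [~: G, G]}},
    graph_component (ac_vertices k (G / [~: G, G])) (ac_edge k (G / [~: G, G])) C ->
    graph_connected (ac_preimage G C) (ac_edge k G).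
Proof.
move=> nilG _ C [t _ defC] h h' Ph Ph'.
have nDG : G \subset 'N([~: G, G]) by rewrite normsR ?normG.
have Gmem g : g \in ac_preimage G C -> forall i, g i \in G.
  by rewrite inE => /andP[/ac_verticesP[]].
have Ct g : g \in ac_preimage G C ->
    connect (ac_edge k (G / [~: G, G])) t (ac_quotient [~: G, G] g).
  by case/setIdP=> _; rewrite defC => /setIdP[_]; apply: connect_induced.
(* The preimage of [C] is closed under edges, since edges project to edges and [C] is a component. A
   path in the whole graph therefore suffices. *)
apply: closed_connect_induced => // [g g' Pg egg'|].
  have eqq := ac_edge_quotient _ _ nDG _ _ (Gmem g Pg) egg'.
  case/setIdP: Pg => Vg; rewrite defC => /setIdP[Vq cq].
  have Vq' := ac_vertices_edge _ _ _ Vq eqq.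
  apply/setIdP; split; first exact: ac_vertices_edge egg'.
  apply/setIdP; split=> //.
  by apply: (connect_trans cq); apply: connect1; rewrite /induced /= Vq Vq'.
(* The path lifted from [h] joins the images of [h] and [h'] through the base point [t] of the
   component. *)
have [h1 c1 eq1] : exists2 h1, connect (ac_edge k G) h h1
    & ac_quotient [~: G, G] h' = ac_quotient [~: G, G] h1.
  apply: (ac_connect_lift _ _ nDG _ _ (Gmem h Ph)).
  by rewrite (connect_trans _ (Ct h' Ph')) // ac_edge_connect_sym Ct.
have Vh1 : h1 \in ac_vertices k G.
  by apply: ac_vertices_connect c1; case/setIdP: Ph.
apply: connect_trans c1 _.
apply: (absorbs_congruent _ _ _ _ (absorbs_der1 _ nilG) Vh1) => i.
have [Gh1 _] := ac_verticesP _ _ Vh1.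
have := congr1 (fun f : {ffun 'I_k -> _} => f i) eq1; rewrite !ffunE => eqi.
have Nh1 : h1 i \in 'N([~: G, G]) by apply: subsetP nDG _ _.
have Nh' : h' i \in 'N([~: G, G]) by apply: subsetP nDG _ (Gmem _ Ph' i).
apply: coset_idr; first by rewrite groupM ?groupV.
by rewrite morphM ?morphV ?groupV //= eqi mulVg.
Qed.
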